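(* Let $n\ge 1$ be an integer and let $\alpha_1,\ldots,\alpha_n,a_1,\ldots,a_n\in\mathbb{R}$. For every integer $N\ge 0$ and all $x\in\mathbb{R}$, $$Q_N^{(\alpha_1+\alpha_2+\cdots+\alpha_n,\,-(a_1+a_2+\cdots+a_n+n-1))}(x)=\sum_{\substack{0\le\nu_j\le N\\ \nu_1+\cdots+\nu_n=N}}\frac{N!}{\prod_{j=1}^n\nu_j!}\prod_{j=1}^n Q_{\nu_j}^{(\alpha_j,-a_j)}(x),$$ where the sum runs over integer tuples $(\nu_1,\ldots,\nu_n)$.
   Context: Throughout $x$ is a real variable, $\alpha,a$ are real parameters, $\sigma(x)=1+x^2$, and $\cot^{-1}:\mathbb{R}\to(0,\pi)$ is the smooth branch, so that $\frac{d}{dx}\cot^{-1}x=-1/\sigma(x)$. For integers $l\ge 0$ put $w_l(x)=\sigma(x)^{-(l+a+1)}e^{-\alpha\cot^{-1}x}=\sigma(x)^{-l}w_0(x)$. Define $P_l^{(a,\alpha)}(x)=\frac{1}{w_l(x)}\frac{d^l}{dx^l}[w_l(x)\sigma(x)^l]=\frac{\sigma(x)^l}{w_0(x)}\frac{d^l w_0(x)}{dx^l}$. The complementary (Romanovski) polynomials $Q_\nu^{(\alpha,-a)}$, with $Q_0^{(\alpha,-a)}\equiv 1$, are defined by the Rodrigues representation $P_l^{(a,\alpha)}(x)=\frac{1}{w_l(x)}\frac{d^{l-\nu}}{dx^{l-\nu}}[\sigma(x)^{l-\nu}w_l(x)Q_\nu^{(\alpha,-a)}(x)]$ for all integers $0\le\nu\le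 l$ (the case $l=\nu$ reads $Q_\nu^{(\alpha,-a)}=P_\nu^{(a,\alpha)}$). The second upper index is minus the parameter $a$ of the weight. *)

(* Defs.v *)
From HB Require Import structures.
From mathcomp Require Import all_boot all_order all_algebra.
From mathcomp Require Import all_classical all_reals all_analysis.
From mathcomp Require Import ring lra.
Set Implicit Arguments.
Unset Strict Implicit.
Unset Printing Implicit Defensive.
Import Order.TTheory GRing.Theory Num.Theory.
Import numFieldNormedType.Exports.
Local Open Scope ring_scope.
Local Open Scope classical_set_scope.

Definition sigma (R : realType) (x : R) : R := 1 + x ^+ 2.

Lemma sigma_gt0 (R : realType) (x : R) : 0 < sigma x.
Proof. by rewrite ltr_pwDl// sqr_ge0. Qed.

(* The smooth branch of cot^-1, not the one that jumps at 0. *)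
Definition acot (R : realType) (x : R) : R := pi / 2 - atan x.

Lemma acot_itv (R : realType) (x : R) : 0 < acot x < pi.
Proof.
by have := atan_gtNpi2 x; have := atan_ltpi2 x; rewrite /acot; lra.
Qed.

Lemma acotK (R : realType) (x : R) : cos (acot x) / sin (acot x) = x.
Proof.
by rewrite /acot sinB cosB sin_pihalf cos_pihalf !mul0r !mul1r add0r subr0 -/(tan _) atanK.
Qed.

Lemma is_derive_acot (R : realType) (x : R) :
  is_derive x 1 (@acot R) (- (sigma x)^-1).
Proof.
rewrite -[- _]add0r.
exact: (is_deriveB (is_derive_cst (pi / 2 : R) x 1) (is_derive1_atan x)).
Qed.

Definition weight (R : realType) (a alpha : R) (l : nat) (x : R) : R :=
  sigma x `^ (- (l%:R + a + 1)) * expR (- alpha * acot x).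

Definition romanovski (R : realType) (a alpha : R) (l : nat) (x : R) : R :=
  (weight a alpha l x)^-1 *
  derive1n l (fun y => weight a alpha l y * sigma y ^+ l) x.

(* [Q alpha b nu] stands for Q_nu^(alpha, b); the weight parameter is a = - b. *)
Definition complementary (R : realType) (Q : R -> R -> nat -> R -> R) : Prop :=
  forall alpha a : R,
    (forall x : R, Q alpha (- a) 0%N x = 1) /\
    (forall (l nu : nat), (nu <= l)%N -> forall x : R,
       romanovski a alpha l x =
       (weight a alpha l x)^-1 *
       derive1n (l - nu) (fun y => sigma y ^+ (l - nu) * weight a alpha l y
                                   * Q alpha (- a) nu y) x).

Lemma weight_gt0 (R : realType) (a alpha : R) l x : 0 < weight a alpha l x.
Proof. by rewrite mulr_gt0 ?expR_gt0// powR_gt0// sigma_gt0. Qed.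

Lemma weight_sigma (R : realType) (a alpha : R) l x :
  weight a alpha l x = sigma x ^- l * weight a alpha 0 x.
Proof.
rewrite /weight mulrA; congr (_ * _).
rewrite -powR_invn ?ltW ?sigma_gt0// -powRD; last first.
  by apply/implyP => _; rewrite gt_eqF// sigma_gt0.
by congr (_ `^ _); rewrite add0r -addrA opprD.
Qed.

Lemma complementary_exists (R : realType) :
  complementary (fun alpha b : R => romanovski (- b) alpha).
Proof.
have s0 (x : R) k : sigma x ^+ k != 0 by rewrite expf_neq0// gt_eqF// sigma_gt0.
have wK (a alpha : R) k :
    (fun y => weight a alpha k y * sigma y ^+ k) = weight a alpha 0.
  apply/funext => y; rewrite (weight_sigma _ _ k) mulrAC mulVf ?mul1r//.
move=> alpha a; rewrite opprK; split=> [x|l nu nul x].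
  rewrite /romanovski wK derive1n0 mulVf// gt_eqF// weight_gt0//.
rewrite {1}/romanovski wK; congr (_ * _).
rewrite (_ : (fun y => _) = derive1n nu (weight a alpha 0)).
  by rewrite /derive1n -iterD subnK.
apply/funext => y; rewrite /romanovski wK !(weight_sigma _ _ nu) (weight_sigma _ _ l).
have -> : sigma y ^+ l = sigma y ^+ (l - nu) * sigma y ^+ nu.
  by rewrite -exprD subnK.
have w0 : weight a alpha 0 y != 0 by rewrite gt_eqF// weight_gt0.
by field; rewrite w0 !s0.
Qed.

Lemma complementary_unique (R : realType) (Q : R -> R -> nat -> R -> R) :
  complementary Q -> Q = (fun alpha b : R => romanovski (- b) alpha).
Proof.
move=> hQ; apply/funext => alpha; apply/funext => b; apply/funext => nu.
apply/funext => x; have [_ /(_ nu nu (leqnn _) x) ->] := hQ alpha (- b).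
rewrite subnn derive1n0 expr0 mul1r opprK mulKf//.
by rewrite gt_eqF// weight_gt0.
Qed.

(* Main.v *)
Require Import Defs.
From mathcomp Require Import all_boot all_order all_algebra.
From mathcomp Require Import all_classical all_reals all_analysis.
From mathcomp Require Import ring.
Import Order.TTheory GRing.Theory Num.Theory.
Local Open Scope ring_scope.

(** Write [c = a + 1] and let [w] be the weight
    [sigma^(-c) * exp (- alpha * acot)], which is [weight a alpha 0].  The case
    [l = nu] of the Rodrigues formula reads [Q_nu = sigma^nu * w^(nu) / w], so
    up to powers of [sigma] the [Q_nu / nu!] are the Taylor coefficients of
    [w] divided by [w].  Adding the parameters [(c, alpha)] multiplies the
    weights, and the parameter [sum a_j + n - 1] of the theorem is the one for
    which [c] is exactly the sum of the [c_j]; hence the generating function of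
    the [Q_nu / nu!] is multiplicative in [(c, alpha)], which is the theorem.

    All the analysis is put into one statement, [derive1n_weight]: the
    logarithmic derivative of [w] is [(alpha - 2 c x) / sigma], so
    [w^(k) = w * q_k / sigma^k] where the polynomials [q_k] obey the first-order
    recurrence [q_(k+1) = (alpha - 2 (c + k) x) q_k + sigma q_k'].  The rest is
    algebra in [{poly R}].  The operators in this recurrence satisfy a Leibniz
    rule in which [c], [alpha] and [k] all add up ([ladderM]), and so the
    [q_k / k!] convolve ([taylor_poly_conv]).  Reading the convolution as the
    product of generating polynomials truncated after degree [N] turns the case
    of [n] factors into the expansion of a product of sums. *)

Section Ladder.
Variable R : numFieldType.
Implicit Types (c alpha : R) (k : nat) (p q : {poly R}).

(** The factor [w / sigma^k] has logarithmic derivative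
    [(alpha - 2 (c + k) x) / sigma], so differentiating [w * p / sigma^k]
    replaces [p] by [ladder c alpha k p] and [k] by [k + 1]. *)
Definition ladder c alpha k p : {poly R} :=
  (alpha%:P - (2 * (c + k%:R)) *: 'X) * p + (1 + 'X^2) * p^`().

Fixpoint rodrigues_poly c alpha k : {poly R} :=
  if k is k'.+1 then ladder c alpha k' (rodrigues_poly c alpha k') else 1.

Definition taylor_poly c alpha k : {poly R} :=
  k`!%:R^-1 *: rodrigues_poly c alpha k.

Lemma ladder_sum c alpha k I r (P : pred I) (F : I -> {poly R}) :
  ladder c alpha k (\sum_(i <- r | P i) F i) =
  \sum_(i <- r | P i) ladder c alpha k (F i).
Proof. by rewrite /ladder raddf_sum !mulr_sumr big_split. Qed.

Lemma ladderZ c alpha k b p : ladder c alpha k (b *: p) = b *: ladder c alpha k p.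
Proof. by rewrite /ladder derivZ -!scalerAr scalerDr. Qed.

(** The multiplication part of [ladder] is additive in [(c, alpha, k)] and the
    remaining part is a derivation. *)
Lemma ladderM c1 c2 alpha1 alpha2 k1 k2 p q :
  ladder (c1 + c2) (alpha1 + alpha2) (k1 + k2) (p * q) =
  ladder c1 alpha1 k1 p * q + p * ladder c2 alpha2 k2 q.
Proof. by rewrite /ladder derivM natrD polyCD -!mul_polyC !polyCM !polyCD; ring. Qed.

Lemma taylor_polyS c alpha k :
  k.+1%:R *: taylor_poly c alpha k.+1 = ladder c alpha k (taylor_poly c alpha k).
Proof.
by rewrite /taylor_poly /= ladderZ scalerA factS natrM invfM mulrA mulfV ?mul1r//.
Qed.

Lemma taylor_poly_conv c1 c2 alpha1 alpha2 N :
  taylor_poly (c1 + c2) (alpha1 + alpha2) N =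
  \sum_(i < N.+1) taylor_poly c1 alpha1 i * taylor_poly c2 alpha2 (N - i).
Proof.
elim: N => [|N IHN].
  by rewrite big_ord1 /taylor_poly /= fact0 invr1 !scale1r mulr1.
(* Splitting the factor N+1 as i + (N+1-i) on each term lets the recurrence act
   on one factor at a time. *)
apply: (@scalerI _ _ N.+1%:R); first by rewrite pnatr_eq0.
rewrite taylor_polyS IHN ladder_sum.
pose e := taylor_poly c1 alpha1; pose f := taylor_poly c2 alpha2.
transitivity (\sum_(i < N.+2) (i%:R *: e i) * f (N.+1 - i)%N
            + \sum_(i < N.+2) e i * ((N.+1 - i)%:R *: f (N.+1 - i)%N)).
  rewrite [X in _ = X + _]big_ord_recl scale0r mul0r add0r.
  rewrite [X in _ = _ + X]big_ord_recr /= subnn scale0r mulr0 addr0 -big_split /=.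
  apply: eq_bigr => i _; have iN : (i <= N)%N by rewrite -ltnS.
  have := ladderM c1 c2 alpha1 alpha2 i (N - i) (e i) (f (N - i)%N).
  by rewrite subnKC// => ->; rewrite -!taylor_polyS /bump/= add1n subSS subSn.
rewrite -big_split scaler_sumr; apply: eq_bigr => i _ /=.
have iN : (i <= N.+1)%N by rewrite -ltnS.
have -> : N.+1%:R = i%:R + (N.+1 - i)%:R :> R by rewrite -natrD subnKC.
by rewrite scalerDl scalerAl scalerAr.
Qed.

(** At [c = alpha = 0] the weight is the constant 1. *)
Lemma taylor_poly00 k : taylor_poly 0 0 k = (k == 0%N)%:R.
Proof.
case: k => [|k]; first by rewrite /taylor_poly /= fact0 invr1 scale1r.
suff -> : taylor_poly 0 0 k.+1 = 0 by [].
rewrite /taylor_poly; suff -> : rodrigues_poly 0 0 k.+1 = 0 by rewrite scaler0.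
elim: k => [|k /= ->]; last by rewrite /ladder linear0 !mulr0 addr0.
rewrite /= /ladder -[1 in X in _ + X]/(1%:P) derivC.
by rewrite addr0 mulr0 scale0r subr0 mulr1 mulr0 addr0.
Qed.

Lemma coef_prod_truncated (S : comNzRingType) (I : finType)
    (F : I -> nat -> S) (N : nat) :
  (\prod_i \poly_(k < N.+1) F i k)`_N =
  \sum_(f : {ffun I -> 'I_N.+1} | (\sum_i f i)%N == N) \prod_i F i (f i).
Proof.
under eq_bigr do rewrite poly_def.
rewrite bigA_distr_bigA coef_sum [RHS]big_mkcond.
apply: eq_bigr => f _.
rewrite scaler_prod -(big_morph (fun k => 'X^k) (exprD _) (expr0 _)).
by rewrite coefZ coefXn eq_sym; case: eqP => _; rewrite ?mulr1 ?mulr0.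
Qed.

(** Truncating each factor after degree [N] does not affect the coefficients
    of the product up to degree [N]. *)
Lemma coef_prod_taylor_poly (I : Type) (r : seq I) (c alpha : I -> R) N m :
  (m <= N)%N ->
  (\prod_(j <- r) \poly_(k < N.+1) taylor_poly (c j) (alpha j) k)`_m =
  taylor_poly (\sum_(j <- r) c j) (\sum_(j <- r) alpha j) m.
Proof.
elim: r m => [|j r IHr] m mN; first by rewrite !big_nil taylor_poly00 coef1.
rewrite !big_cons coefM taylor_poly_conv; apply: eq_bigr => i _.
rewrite IHr ?(leq_trans (leq_subr _ _))// coef_poly.
by rewrite ltnS (leq_trans _ mN)// -ltnS.
Qed.

Lemma rodrigues_poly_multinomial (I : finType) (c alpha : I -> R) N :
  rodrigues_poly (\sum_j c j) (\sum_j alpha j) N =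
  \sum_(nu : {ffun I -> 'I_N.+1} | (\sum_j nu j)%N == N)
    (N`!%:R / \prod_j (nu j)`!%:R) *:
    \prod_j rodrigues_poly (c j) (alpha j) (nu j).
Proof.
have N0 : N`!%:R != 0 :> R by rewrite pnatr_eq0 -lt0n fact_gt0.
transitivity (N`!%:R *: taylor_poly (\sum_j c j) (\sum_j alpha j) N).
  by rewrite scalerA mulfV// scale1r.
rewrite -(@coef_prod_taylor_poly _ _ _ _ N)// coef_prod_truncated scaler_sumr.
apply: eq_bigr => nu _; rewrite -scalerA; congr (_ *: _).
by rewrite scaler_prod prodfV.
Qed.

End Ladder.

Arguments ladder {R}.
Arguments rodrigues_poly {R}.

Section Weight.
Variable R : realType.
Implicit Types (a alpha x : R) (k : nat).

Lemma hornerE_sigma x : (1 + 'X^2 : {poly R}).[x] = sigma x.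
Proof. by rewrite /sigma !hornerE. Qed.

Lemma is_derive_sigma x : is_derive x 1 (@sigma R) (2 * x).
Proof.
rewrite (_ : @sigma R = horner (1 + 'X^2)); last first.
  by apply/funext => y; rewrite hornerE_sigma.
apply: is_derive_eq.
by rewrite derivD derivXn -[1 in X in X + _]/(1%:P) derivC !hornerE/= mulr2n; ring.
Qed.

Lemma is_derive_weight a alpha x :
  is_derive x 1 (weight a alpha 0)
    (weight a alpha 0 x * (alpha - 2 * (a + 1) * x) / sigma x).
Proof.
have sx := sigma_gt0 x; have sx0 : sigma x != 0 by rewrite gt_eqF.
have dpow := is_derive1_comp (is_derive1_powR (- (0%:R + a + 1)) sx) (is_derive_sigma x).
have dacot : is_derive x 1 (fun y => - alpha * acot y) (alpha / sigma x).
  by apply: is_derive_eq (is_deriveZ (- alpha) (is_derive_acot x)) _; rewrite /GRing.scale /= mulrNN.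
have dexp := @is_derive1_comp _ _ (fun y => - alpha * acot y) _ _ _ (is_derive_expR _) dacot.
have dw : is_derive x 1 (weight a alpha 0) _ := is_deriveM dpow dexp.
apply: (is_derive_eq dw).
rewrite /= /weight powRB ?sx0 ?implybT// powRr1 ?ltW// /GRing.scale /=.
by field.
Qed.

Lemma derive1n_weight a alpha k :
  derive1n k (weight a alpha 0) =
  fun x => weight a alpha 0 x *
           (rodrigues_poly (a + 1) alpha k).[x] / sigma x ^+ k.
Proof.
elim: k => [|k IHk]; apply/funext => x.
  by rewrite derive1n0 /= hornerE expr0 divr1 mulr1.
have sx0 : sigma x != 0 by rewrite gt_eqF// sigma_gt0.
have skx0 : ((@sigma R) ^+ k) x != 0 by rewrite fctE expf_neq0.
rewrite derive1nS IHk derive1E.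
set p := rodrigues_poly _ _ _.
have dwp := is_deriveM (is_derive_weight a alpha x) (is_derive_poly p x).
have dV := is_deriveV skx0 (is_deriveX k (is_derive_sigma x)).
have dq := is_deriveM dwp dV.
transitivity ('D_1 ((weight a alpha 0 * horner p) * (fun y => (((@sigma R) ^+ k) y)^-1)) x).
  by congr ('D_1 _ x); apply/funext => y; rewrite !fctE.
rewrite (@derive_val _ _ _ _ _ _ _ dq) /= -/p /ladder !fctE /GRing.scale /=.
rewrite hornerD !hornerM hornerE_sigma hornerD hornerN hornerC hornerZ hornerX.
(* The exponent [k.-1] in the derivative of [sigma ^+ k] forces a case split. *)
case: k {IHk skx0 dV dq dwp} @p => [|k] p.
  by rewrite /= !expr0 expr1; field.
by rewrite /= !exprS; field; rewrite expf_neq0 ?sx0.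
Qed.

Lemma romanovskiE a alpha k x :
  romanovski a alpha k x = (rodrigues_poly (a + 1) alpha k).[x].
Proof.
have s0 (y : R) : sigma y ^+ k != 0 by rewrite expf_neq0// gt_eqF// sigma_gt0.
have w0 : weight a alpha 0 x != 0 by rewrite gt_eqF// weight_gt0.
rewrite /romanovski (_ : (fun y => _) = weight a alpha 0); last first.
  by apply/funext => y; rewrite (weight_sigma _ _ k) mulrAC mulVf ?mul1r.
by rewrite derive1n_weight weight_sigma; field; rewrite w0 s0.
Qed.

End Weight.

Theorem theorem2p2 (R : realType) (Q : R -> R -> nat -> R -> R)
    (hQ : complementary Q)
    (n : nat) (hn : (1 <= n)%N) (alpha a : 'I_n -> R) (N : nat) (x : R) :
  Q (\sum_(j < n) alpha j) (- (\sum_(j < n) a j + n%:R - 1)) N x =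
  \sum_(nu : {ffun 'I_n -> 'I_N.+1} | (\sum_(j < n) nu j)%N == N)
    (N`!%:R / \prod_(j < n) (nu j)`!%:R) *
    \prod_(j < n) Q (alpha j) (- a j) (nu j) x.
Proof.
rewrite (complementary_unique hQ) romanovskiE opprK subrK.
have -> : \sum_(j < n) a j + n%:R = \sum_(j < n) (a j + 1).
  by rewrite big_split /= sumr_const card_ord.
rewrite rodrigues_poly_multinomial horner_sum; apply: eq_bigr => nu _.
rewrite hornerZ horner_prod; congr (_ * _).
by apply: eq_bigr => j _; rewrite romanovskiE opprK.
Qed.
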